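(* Let $I$ be an isotopy in $\mathrm{Homeo}_0(\mathbb{A})$ from the identity to a homeomorphism $f$, and suppose $\rho_{\mathrm{ann}}(I)$ contains both a positive and a negative real number. Then there exists a compact (not necessarily invariant) set $K\subset\mathbb{A}$ such that $0\in\rho_K(I)$.
   Context: $\mathbb{T}^1=\mathbb{R}/\mathbb{Z}$, $\mathbb{A}=\mathbb{T}^1\times\mathbb{R}$ is the open annulus with universal covering $\pi:\mathbb{R}^2\to\mathbb{A}$ and $p_1:\mathbb{R}^2\to\mathbb{R}$ the first coordinate projection. $\mathrm{Homeo}_0(\mathbb{A})$ is the set of homeomorphisms of $\mathbb{A}$ isotopic to the identity. For an isotopy $I=(f_t)_{t\in[0,1]}$ from the identity to $f=f_1$, let $(\tilde f_t)$ be its lift to $\mathbb{R}^2$ with $\tilde f_0=\mathrm{Id}$, and $\tilde f=\tilde f_1$. For $z\in\mathbb{A}$ and $n\ge1$, $\rho_n(z)=\frac1n(p_1(\tilde f^n(\tilde z))-p_1(\tilde z))$ with $\tilde z\in\pi^{-1}(z)$. For a compact $K\subset\mathbb{A}$, $\rho_K(I)=\bigcap_{m\ge1}\mathrm{Cl}\big(\bigcup_{n\ge m}\{\rho_n(z): z\in K,\ f^n(z)\in K\}\big)$, closure in $\overline{\mathbb{R}}=\mathbb{R}\cup\{\pm\infty\}$, and $\rho_{\mathrm{ann}}(I)=\mathrm{Cl}\big(\bigcup_K\rho_K(I)\big)$, union over all compact $K\subset\mathbb{A}$. *)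

(* Defs.v *)
From Stdlib Require Import Reals.
Open Scope R_scope.

(* The universal cover R^2 of the annulus A = T^1 x R, with covering map
   pi(x,y) = (x mod 1, y) and deck transformation T(x,y) = (x+1,y). *)
Definition pt : Type := (R * R)%type.
Definition p1 (z : pt) : R := fst z.
Definition deckT (z : pt) : pt := (fst z + 1, snd z).

Definition dist2 (z w : pt) : R := Rmax (Rabs (fst z - fst w)) (Rabs (snd z - snd w)).

Definition cont2 (h : pt -> pt) : Prop :=
  forall z eps, 0 < eps -> exists delta, 0 < delta /\
    forall w, dist2 w z < delta -> dist2 (h w) (h z) < eps.

Definition homeo2 (h : pt -> pt) : Prop :=
  cont2 h /\ exists g : pt -> pt, cont2 g /\
    (forall z, g (h z) = z) /\ (forall z, h (g z) = z).

(* Lift (tilde f_t)_{t in [0,1]} to R^2 of an isotopy I = (f_t) in Homeo_0(A)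
   from the identity, normalized by tilde f_0 = Id.  Isotopies on A correspond
   exactly to such deck-equivariant isotopies on R^2. *)
Definition lifted_isotopy (H : R -> pt -> pt) : Prop :=
  (forall t z eps, 0 <= t <= 1 -> 0 < eps -> exists delta, 0 < delta /\
     forall s w, 0 <= s <= 1 -> Rabs (s - t) < delta -> dist2 w z < delta ->
       dist2 (H s w) (H t z) < eps) /\
  (forall z, H 0 z = z) /\
  (forall t, 0 <= t <= 1 -> homeo2 (H t)) /\
  (forall t z, 0 <= t <= 1 -> H t (deckT z) = deckT (H t z)).

(* A subset K of A is represented by its full preimage Kt = pi^{-1}(K) in R^2
   (a deck-invariant set).  K is compact in A = T^1 x R iff Kt is closed in
   R^2 and bounded in the second coordinate. *)
Definition compact_annulus (Kt : pt -> Prop) : Prop :=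
  (forall z, Kt z <-> Kt (deckT z)) /\
  (forall z, ~ Kt z -> exists delta, 0 < delta /\ forall w, dist2 w z < delta -> ~ Kt w) /\
  (exists M, forall z, Kt z -> Rabs (snd z) <= M).

Definition rho_n (F : pt -> pt) (n : nat) (z : pt) : R :=
  (p1 (Nat.iter n F z) - p1 z) / INR n.

(* A real number r belongs to rho_K(I) (intersection over m of the closures
   in the extended line of the sets {rho_n(z) : n >= m, z in K, f^n(z) in K};
   on real points closure in Rbar agrees with closure in R). *)
Definition in_rho_K (F : pt -> pt) (Kt : pt -> Prop) (r : R) : Prop :=
  forall (m : nat) eps, 0 < eps -> exists (n : nat) (z : pt),
    (1 <= n)%nat /\ (m <= n)%nat /\ Kt z /\ Kt (Nat.iter n F z) /\
    Rabs (rho_n F n z - r) < eps.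

(* A real number r belongs to rho_ann(I), the closure in Rbar of the union of
   the rho_K(I) over compact K (small neighbourhoods of a real r in Rbar
   contain only real numbers). *)
Definition in_rho_ann (F : pt -> pt) (r : R) : Prop :=
  forall eps, 0 < eps -> exists (Kt : pt -> Prop) (s : R),
    compact_annulus Kt /\ in_rho_K F Kt s /\ Rabs (s - r) < eps.

(* Main.v *)
Require Import Defs.
From Stdlib Require Import Reals Lra Lia ZArith Classical.
Open Scope R_scope.

(** Suppose that 0 lies in no rho_K, and let K range over the closed annuli
    |y| <= M.  A segment of K and its deck translate have disjoint images under
    f^n; since an arc over a horizontal line meets its unit translate as soon as
    its endpoints are more than 1 apart, the displacements of the points of K
    returning to K at time n have no gap of length more than 2.  For n large they
    avoid a neighbourhood of 0 of size proportional to n, so they all have the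
    same sign, and if K met f^n(K) for all large n this sign could not change
    from n to n+1.  As both signs occur for arbitrarily large n, every K is
    disjoint from some f^n(K), and the isotopy being end-preserving, f^n pushes
    the half annulus beyond K.  Applying this to K and to a larger annulus shows
    that K never returns to itself after some time, which contradicts the
    hypothesis. *)

(** * Continuity and compactness on the line *)

Lemma continuity_of_eps (f : R -> R) :
  (forall x eps, 0 < eps -> exists d, 0 < d /\
     forall y, Rabs (y - x) < d -> Rabs (f y - f x) < eps) ->
  continuity f.
Proof.
  intros Hf x eps Heps. destruct (Hf x eps Heps) as [d [Hd Hy]].
  exists d; split; [exact Hd|].
  intros y [_ Hyx]. apply Hy, Hyx.
Qed.

Lemma continuity_eps (f : R -> R) (x eps : R) :
  continuity f -> 0 < eps -> exists d, 0 < d /\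
    forall y, Rabs (y - x) < d -> Rabs (f y - f x) < eps.
Proof.
  intros Hf Heps. destruct (Hf x eps Heps) as [d [Hd Hy]].
  exists d; split; [exact Hd|].
  intros y Hyx. destruct (Req_dec x y) as [<-|Hne].
  - rewrite Rminus_diag, Rabs_R0. exact Heps.
  - apply Hy. split; [split; [exact I|exact Hne]|exact Hyx].
Qed.

Lemma continuity_gt_near (f : R -> R) (x c : R) :
  continuity f -> c < f x -> exists d, 0 < d /\
    forall y, Rabs (y - x) < d -> c < f y.
Proof.
  intros Hf Hx. destruct (continuity_eps f x (f x - c) Hf) as [d [Hd Hy]]; [lra|].
  exists d; split; [exact Hd|].
  intros y Hyx. apply Hy, Rabs_def2 in Hyx. lra.
Qed.

Lemma continuity_lt_near (f : R -> R) (x c : R) :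
  continuity f -> f x < c -> exists d, 0 < d /\
    forall y, Rabs (y - x) < d -> f y < c.
Proof.
  intros Hf Hx. destruct (continuity_eps f x (c - f x) Hf) as [d [Hd Hy]]; [lra|].
  exists d; split; [exact Hd|].
  intros y Hyx. apply Hy, Rabs_def2 in Hyx. lra.
Qed.

Lemma IVT_value (f : R -> R) (a b c : R) :
  continuity f -> a <= b -> f a <= c <= f b \/ f b <= c <= f a ->
  exists s, a <= s <= b /\ f s = c.
Proof.
  assert (Hinc : forall g, continuity g -> a <= b -> g a <= 0 <= g b ->
            exists s, a <= s <= b /\ g s = 0).
  { intros g Hg Hab Hv.
    destruct (Req_dec (g a) 0) as [Ha|Ha]; [exists a; split; [lra|exact Ha]|].
    destruct (Req_dec (g b) 0) as [Hb|Hb]; [exists b; split; [lra|exact Hb]|].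
    destruct (Req_dec a b) as [E|E]; [subst; lra|].
    destruct (IVT g a b Hg) as [s Hs]; [lra|lra|lra|].
    exists s; exact Hs. }
  intros Hf Hab [Hv|Hv].
  - destruct (Hinc (fun s => f s - c)) as [s [Hs E]]; [|exact Hab|lra|].
    + apply (continuity_minus f (fun _ => c)); [exact Hf|].
      apply continuity_const; intros ? ?; reflexivity.
    + exists s; split; [exact Hs|lra].
  - destruct (Hinc (fun s => c - f s)) as [s [Hs E]]; [|exact Hab|lra|].
    + apply (continuity_minus (fun _ => c) f); [|exact Hf].
      apply continuity_const; intros ? ?; reflexivity.
    + exists s; split; [exact Hs|lra].
Qed.

(** Compactness of [[a, b]], with [P d x] read as the radius [d] being good at [x]. Take the
    supremum of the [s] for which one radius serves all of [[a, s]]: the local radius there carries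
    the property further, unless [b] is already reached. *)
Lemma uniform_radius_1d (a b : R) (P : R -> R -> Prop) :
  (forall d d' x, 0 < d' <= d -> P d x -> P d' x) ->
  (forall x, a <= x <= b -> exists d, 0 < d /\
     forall y, a <= y <= b -> Rabs (y - x) < d -> P d y) ->
  exists d, 0 < d /\ forall y, a <= y <= b -> P d y.
Proof.
  intros Hmono Hloc.
  destruct (Rle_dec a b) as [Hab|Hab]; [|exists 1; split; [lra|intros; lra]].
  set (E := fun s => a <= s <= b /\
              exists d, 0 < d /\ forall y, a <= y <= s -> P d y).
  destruct (completeness E) as [m [Hub Hlub]].
  - exists b. intros s [Hs _]. lra.
  - exists a. split; [lra|].
    destruct (Hloc a) as [d [Hd Hy]]; [lra|].
    exists d; split; [exact Hd|]. intros y Hya. replace y with a by lra.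
    apply Hy; [lra|]. rewrite Rminus_diag, Rabs_R0. exact Hd.
  - assert (Ham : a <= m).
    { apply Hub. split; [lra|].
      destruct (Hloc a) as [d [Hd Hy]]; [lra|].
      exists d; split; [exact Hd|]. intros y Hya. replace y with a by lra.
      apply Hy; [lra|]. rewrite Rminus_diag, Rabs_R0. exact Hd. }
    assert (Hmb : m <= b) by (apply Hlub; intros s [Hs _]; lra).
    destruct (Hloc m) as [d [Hd Hy]]; [lra|].
    assert (Hs : exists s, E s /\ m - d < s).
    { apply NNPP; intros Hn.
      assert (m <= m - d); [|lra]. apply Hlub. intros s Hs.
      destruct (Rle_dec s (m - d)) as [|Hn']; [assumption|].
      exfalso; apply Hn. exists s; split; [exact Hs|lra]. }
    destruct Hs as [s [[Hsab [d1 [Hd1 Hs1]]] Hsm]].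
    assert (Hext : forall y, a <= y <= Rmin b (m + d / 2) -> P (Rmin d d1) y).
    { intros y Hyb.
      pose proof (Rmin_l b (m + d / 2)); pose proof (Rmin_r b (m + d / 2)).
      pose proof (Rmin_glb_lt d d1 0 Hd Hd1).
      destruct (Rle_dec y s).
      - apply (Hmono d1); [split; [assumption|apply Rmin_r]|]. apply Hs1; lra.
      - apply (Hmono d); [split; [assumption|apply Rmin_l]|].
        apply Hy; [lra|]. apply Rabs_def1; lra. }
    (* The extended interval still belongs to [E], hence ends at or before [m]; as [d] is positive,
       the minimum must be [b]. *)
    assert (Hle : Rmin b (m + d / 2) <= m).
    { apply Hub. split.
      - split; [apply Rmin_glb; lra|apply Rmin_l].
      - exists (Rmin d d1). split; [apply Rmin_glb_lt; assumption|exact Hext]. }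
    exists (Rmin d d1). split; [apply Rmin_glb_lt; assumption|].
    intros y Hyb. apply Hext. split; [lra|].
    revert Hle. unfold Rmin at 1 2. destruct (Rle_dec b (m + d / 2)); lra.
Qed.

(** A tube argument: for fixed [x], compactness in the second variable gives a radius good on a
    whole vertical tube around [x], which is the local hypothesis needed for compactness in the
    first variable. *)
Lemma uniform_radius_2d (a b a' b' : R) (P : R -> R -> R -> Prop) :
  (forall d d' x x', 0 < d' <= d -> P d x x' -> P d' x x') ->
  (forall x x', a <= x <= b -> a' <= x' <= b' -> exists d, 0 < d /\
     forall y y', a <= y <= b -> a' <= y' <= b' ->
       Rabs (y - x) < d -> Rabs (y' - x') < d -> P d y y') ->
  exists d, 0 < d /\ forall y y', a <= y <= b -> a' <= y' <= b' -> P d y y'.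
Proof.
  intros Hmono Hloc.
  destruct (uniform_radius_1d a b
    (fun d y => forall y', a' <= y' <= b' -> P d y y')) as [d [Hd Hy]].
  - intros d d' x Hd Hx y' Hy'. apply (Hmono d); [exact Hd|]. apply Hx, Hy'.
  - intros x Hx.
    destruct (uniform_radius_1d a' b'
      (fun d y' => forall y, a <= y <= b -> Rabs (y - x) < d -> P d y y'))
      as [d [Hd Hy]].
    + intros d d' y' Hd Hy y Hyab Hyx. apply (Hmono d); [exact Hd|].
      apply Hy; [exact Hyab|lra].
    + intros x' Hx'. destruct (Hloc x x' Hx Hx') as [d [Hd Hy]].
      exists d; split; [exact Hd|]. intros; apply Hy; assumption.
    + exists d; split; [exact Hd|]. intros; apply Hy; assumption.
  - exists d; split; [exact Hd|]. intros; apply Hy; assumption.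
Qed.

(** * Extreme points of closed sets of reals *)

Definition closed_set (E : R -> Prop) : Prop :=
  forall s, ~ E s -> exists d, 0 < d /\ forall s', Rabs (s' - s) < d -> ~ E s'.

Lemma closed_set_le (f : R -> R) (c : R) :
  continuity f -> closed_set (fun s => f s <= c).
Proof.
  intros Hf s Hs. destruct (continuity_gt_near f s c Hf) as [d [Hd Hy]]; [lra|].
  exists d; split; [exact Hd|]. intros s' Hs'. specialize (Hy s' Hs'). lra.
Qed.

Lemma closed_set_ge (f : R -> R) (c : R) :
  continuity f -> closed_set (fun s => c <= f s).
Proof.
  intros Hf s Hs. destruct (continuity_lt_near f s c Hf) as [d [Hd Hy]]; [lra|].
  exists d; split; [exact Hd|]. intros s' Hs'. specialize (Hy s' Hs'). lra.
Qed.

Lemma closed_set_and (E E' : R -> Prop) :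
  closed_set E -> closed_set E' -> closed_set (fun s => E s /\ E' s).
Proof.
  intros HE HE' s Hs. destruct (classic (E s)) as [Es|Es].
  - destruct (HE' s) as [d [Hd Hy]]; [tauto|].
    exists d; split; [exact Hd|]. intros s' Hs'. specialize (Hy s' Hs'). tauto.
  - destruct (HE s) as [d [Hd Hy]]; [tauto|].
    exists d; split; [exact Hd|]. intros s' Hs'. specialize (Hy s' Hs'). tauto.
Qed.

Lemma closed_set_max (E : R -> Prop) (b : R) :
  closed_set E -> (exists s, E s) -> (forall s, E s -> s <= b) ->
  exists m, E m /\ forall s, E s -> s <= m.
Proof.
  intros HE Hne Hb. destruct (completeness E) as [m [Hub Hlub]].
  - exists b; exact Hb.
  - exact Hne.
  - exists m; split; [|exact Hub].
    apply NNPP; intros Hm. destruct (HE m Hm) as [d [Hd Hy]].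
    assert (m <= m - d); [|lra]. apply Hlub. intros s Hs.
    destruct (Rle_dec s (m - d)) as [|Hn]; [assumption|].
    exfalso. apply (Hy s); [|exact Hs].
    specialize (Hub s Hs). apply Rabs_def1; lra.
Qed.

Lemma closed_set_min (E : R -> Prop) (a : R) :
  closed_set E -> (exists s, E s) -> (forall s, E s -> a <= s) ->
  exists m, E m /\ forall s, E s -> m <= s.
Proof.
  intros HE [s0 Hs0] Ha.
  destruct (closed_set_max (fun s => E (- s)) (- a)) as [m [Hm Hmax]].
  - intros s Hs. destruct (HE (- s) Hs) as [d [Hd Hy]].
    exists d; split; [exact Hd|]. intros s' Hs'. apply Hy.
    replace (- s' - - s) with (- (s' - s)) by ring. rewrite Rabs_Ropp. exact Hs'.
  - exists (- s0). rewrite Ropp_involutive. exact Hs0.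
  - intros s Hs. specialize (Ha _ Hs). lra.
  - exists (- m); split; [exact Hm|]. intros s Hs.
    assert (- s <= m); [apply Hmax; rewrite Ropp_involutive; exact Hs|lra].
Qed.

(** * Horizontal chords of a path in a half plane *)

(** A discrete angle on the plane without the origin. In clockwise order the sectors are [Upper],
    [LowerRight], [LowerLeft], and [turn] counts clockwise crossings, so a full turn amounts to
    3. *)
Inductive sector := Upper | LowerRight | LowerLeft.

Definition sector_of (u v : R) : sector :=
  if Rlt_dec 0 v then Upper else if Rlt_dec 0 u then LowerRight else LowerLeft.

Definition turn (l l' : sector) : Z :=
  match l, l' with
  | Upper, LowerRight | LowerRight, LowerLeft | LowerLeft, Upper => 1
  | LowerRight, Upper | LowerLeft, LowerRight | Upper, LowerLeft => -1
  | _, _ => 0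
  end%Z.

Fixpoint total_turn (l : nat -> sector) (n : nat) : Z :=
  match n with
  | O => 0%Z
  | S k => (total_turn l k + turn (l k) (l (S k)))%Z
  end.

(** The sum telescopes. A potential exists as soon as one of the three kinds of crossing is
    excluded, which cuts the cycle of sectors open. *)
Lemma total_turn_potential (l : nat -> sector) (p : sector -> Z) (n : nat) :
  (forall i, (i < n)%nat -> turn (l i) (l (S i)) = p (l (S i)) - p (l i))%Z ->
  (total_turn l n = p (l n) - p (l O))%Z.
Proof.
  induction n as [|n IH]; intros Hp; cbn [total_turn]; [lia|].
  rewrite IH, Hp; [lia|lia|]. intros i Hi. apply Hp; lia.
Qed.

(** Discrete homotopy invariance: moving a lattice path across one cell keeps its total turn, so the
    two boundary routes from [(0, 0)] to [(n, m)] agree. *)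
Lemma total_turn_grid (l : nat -> nat -> sector) (n m : nat) :
  (forall i j, (i < n)%nat -> (j < m)%nat ->
     turn (l i j) (l (S i) j) + turn (l (S i) j) (l (S i) (S j))
     = turn (l i j) (l i (S j)) + turn (l i (S j)) (l (S i) (S j)))%Z ->
  (total_turn (fun i => l i O) n + total_turn (l n) m
   = total_turn (l O) m + total_turn (fun i => l i m) n)%Z.
Proof.
  intros Hcell. induction n as [|n IH]; cbn [total_turn]; [lia|].
  (* The path is moved across one column, one cell at a time. *)
  assert (Hcol : forall k, (k <= m)%nat ->
    (turn (l n O) (l (S n) O) + total_turn (l (S n)) k
     = total_turn (l n) k + turn (l n k) (l (S n) k))%Z).
  { induction k as [|k IHk]; intros Hk; cbn [total_turn]; [lia|].
    specialize (Hcell n k ltac:(lia) ltac:(lia)).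
    specialize (IHk ltac:(lia)). lia. }
  specialize (Hcol m (le_n m)).
  rewrite (Z.add_comm (total_turn (fun i => l i O) n)) in *.
  specialize (IH ltac:(intros; apply Hcell; lia)). lia.
Qed.

(* A chord is a zero of (s,t) |-> (X t - X s - 1, Y t - Y s) on [a,b]^2; this map
   turns once around the origin along the boundary of the square. *)
Lemma unit_chord_half_plane (X Y : R -> R) (a b : R) :
  continuity X -> continuity Y -> a < b ->
  (forall s, a <= s <= b -> Y a <= Y s) -> Y b = Y a -> X a + 1 < X b ->
  exists s t, a <= s <= b /\ a <= t <= b /\ X t = X s + 1 /\ Y t = Y s.
Proof.
  intros HX HY Hab HYge HYab HXab. apply NNPP; intros Hno.
  set (U := fun s t => X t - X s - 1). set (V := fun s t => Y t - Y s).
  (* Without a chord [(U, V)] never vanishes, so near each point one coordinate keeps a strict sign;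
     compactness of the square gives this at a single scale [d]. *)
  set (signed := fun (Q : R -> R -> Prop) =>
    (forall s t, Q s t -> 0 < V s t) \/ (forall s t, Q s t -> V s t < 0) \/
    (forall s t, Q s t -> 0 < U s t) \/ (forall s t, Q s t -> U s t < 0)).
  destruct (uniform_radius_2d a b a b (fun d s t =>
    signed (fun s' t' => Rabs (s' - s) < d /\ Rabs (t' - t) < d)))
    as [d [Hd Hsign]].
  { intros d d' s t Hd [H|[H|[H|H]]]; [left|right; left|right; right; left|right; right; right];
      intros s' t' [H1 H2]; apply H; lra. }
  { intros s t Hs Ht.
    assert (Hnear : forall eps, 0 < eps -> exists d, 0 < d /\
      forall s' t', Rabs (s' - s) < d -> Rabs (t' - t) < d ->
        Rabs (U s' t' - U s t) < eps /\ Rabs (V s' t' - V s t) < eps).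
    { intros eps Heps.
      destruct (continuity_eps X s (eps / 2) HX) as [d1 [Hd1 H1]]; [lra|].
      destruct (continuity_eps X t (eps / 2) HX) as [d2 [Hd2 H2]]; [lra|].
      destruct (continuity_eps Y s (eps / 2) HY) as [d3 [Hd3 H3]]; [lra|].
      destruct (continuity_eps Y t (eps / 2) HY) as [d4 [Hd4 H4]]; [lra|].
      exists (Rmin (Rmin d1 d2) (Rmin d3 d4)). split.
      - repeat apply Rmin_glb_lt; assumption.
      - intros s' t' Hs' Ht'.
        pose proof (Rmin_l (Rmin d1 d2) (Rmin d3 d4)).
        pose proof (Rmin_r (Rmin d1 d2) (Rmin d3 d4)).
        pose proof (Rmin_l d1 d2); pose proof (Rmin_r d1 d2).
        pose proof (Rmin_l d3 d4); pose proof (Rmin_r d3 d4).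
        specialize (H1 s' ltac:(lra)); specialize (H2 t' ltac:(lra)).
        specialize (H3 s' ltac:(lra)); specialize (H4 t' ltac:(lra)).
        apply Rabs_def2 in H1, H2, H3, H4.
        unfold U, V; split; apply Rabs_def1; lra. }
    assert (Hsg : exists d, 0 < d /\
      signed (fun s' t' => Rabs (s' - s) < d /\ Rabs (t' - t) < d)).
    { destruct (Rtotal_order (V s t) 0) as [HV|[HV|HV]].
      - destruct (Hnear (- V s t)) as [d [Hd H]]; [lra|].
        exists d; split; [exact Hd|]. right; left. intros s' t' [H1 H2].
        destruct (H s' t' H1 H2) as [_ H3]. apply Rabs_def2 in H3. lra.
      - destruct (Rtotal_order (U s t) 0) as [HU|[HU|HU]].
        + destruct (Hnear (- U s t)) as [d [Hd H]]; [lra|].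
          exists d; split; [exact Hd|]. right; right; right. intros s' t' [H1 H2].
          destruct (H s' t' H1 H2) as [H3 _]. apply Rabs_def2 in H3. lra.
        + exfalso; apply Hno. exists s, t. unfold U, V in *.
          repeat split; lra.
        + destruct (Hnear (U s t)) as [d [Hd H]]; [lra|].
          exists d; split; [exact Hd|]. right; right; left. intros s' t' [H1 H2].
          destruct (H s' t' H1 H2) as [H3 _]. apply Rabs_def2 in H3. lra.
      - destruct (Hnear (V s t)) as [d [Hd H]]; [lra|].
        exists d; split; [exact Hd|]. left. intros s' t' [H1 H2].
        destruct (H s' t' H1 H2) as [_ H3]. apply Rabs_def2 in H3. lra. }
    destruct Hsg as [d [Hd Hsg]].
    assert (Hball : forall y y', Rabs (y - s) < d / 2 -> Rabs (y' - t) < d / 2 ->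
      forall s' t', Rabs (s' - y) < d / 2 /\ Rabs (t' - y') < d / 2 ->
        Rabs (s' - s) < d /\ Rabs (t' - t) < d).
    { intros y y' H1 H2 s' t' [H3 H4].
      apply Rabs_def2 in H1, H2, H3, H4. split; apply Rabs_def1; lra. }
    exists (d / 2); split; [lra|]. intros y y' _ _ H1 H2.
    destruct Hsg as [H|[H|[H|H]]]; [left|right; left|right; right; left|right; right; right];
      intros s' t' H3; apply H, (Hball y y' H1 H2 s' t' H3). }
  (* [N] makes the mesh of the grid smaller than [d]. *)
  destruct (archimed_cor1 (d / (b - a))) as [N [HN HN0]].
  { apply Rdiv_lt_0_compat; lra. }
  assert (HNpos : 0 < INR N) by (apply lt_0_INR; exact HN0).
  set (g := fun i : nat => a + INR i * ((b - a) / INR N)).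
  assert (Hstep : 0 < (b - a) / INR N < d).
  { split; [apply Rdiv_lt_0_compat; lra|].
    apply (Rmult_lt_compat_l (b - a)) in HN; [|lra].
    replace ((b - a) * (d / (b - a))) with d in HN by (field; lra).
    exact HN. }
  assert (Hg0 : g O = a) by (unfold g; simpl; ring).
  assert (HgN : g N = b) by (unfold g; field; lra).
  assert (HgS : forall i, g (S i) = g i + (b - a) / INR N)
    by (intros i; unfold g; rewrite S_INR; ring).
  assert (Hg : forall i, (i <= N)%nat -> a <= g i <= b).
  { intros i Hi. apply le_INR in Hi. rewrite <- HgN. unfold g.
    pose proof (pos_INR i). split; [nra|].
    apply Rplus_le_compat_l, Rmult_le_compat_r; lra. }
  assert (Hself : forall i, Rabs (g i - g i) < d)
    by (intros i; rewrite Rminus_diag, Rabs_R0; exact Hd).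
  assert (Hnext : forall i, Rabs (g (S i) - g i) < d)
    by (intros i; rewrite HgS; apply Rabs_def1; lra).
  set (l := fun i j => sector_of (U (g i) (g j)) (V (g i) (g j))).
  assert (Hgrid := total_turn_grid l N N).
  (* The four corners of a cell share one open half plane [V > 0], [V < 0], [U > 0] or [U < 0]. Each
     of these meets at most two sectors, so no net turn around the cell is possible. *)
  assert (Hcell : forall i j, (i < N)%nat -> (j < N)%nat ->
     (turn (l i j) (l (S i) j) + turn (l (S i) j) (l (S i) (S j))
     = turn (l i j) (l i (S j)) + turn (l i (S j)) (l (S i) (S j)))%Z).
  { intros i j Hi Hj. unfold l, sector_of.
    destruct (Hsign (g i) (g j) (Hg i ltac:(lia)) (Hg j ltac:(lia)))
      as [H|[H|[H|H]]];
    pose proof (H _ _ (conj (Hself i) (Hself j)));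
    pose proof (H _ _ (conj (Hnext i) (Hself j)));
    pose proof (H _ _ (conj (Hself i) (Hnext j)));
    pose proof (H _ _ (conj (Hnext i) (Hnext j)));
    repeat (destruct (Rlt_dec _ _); try lra); reflexivity. }
  specialize (Hgrid Hcell).
  (* Along the sides s = a and s = b the image stays in {V >= 0}, so it cannot
     jump between the two lower sectors; along t = a and t = b it stays in
     {V <= 0} and never enters the upper one. *)
  set (pu := fun q => match q with Upper => 1 | LowerRight => 2 | LowerLeft => 0 end%Z).
  set (pl := fun q => match q with Upper => 0 | LowerRight => 0 | LowerLeft => 1 end%Z).
  assert (Hvert : forall i, (i <= N)%nat -> (forall t, a <= t <= b -> 0 <= V (g i) t) ->
    (total_turn (l i) N = pu (l i N) - pu (l i O))%Z).
  { intros i Hi HV. apply total_turn_potential. intros j Hj.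
    pose proof (HV _ (Hg j ltac:(lia))). pose proof (HV _ (Hg (S j) ltac:(lia))).
    unfold l, sector_of.
    destruct (Hsign (g i) (g j) (Hg i Hi) (Hg j ltac:(lia))) as [H'|[H'|[H'|H']]];
    pose proof (H' _ _ (conj (Hself i) (Hself j)));
    pose proof (H' _ _ (conj (Hself i) (Hnext j)));
    repeat (destruct (Rlt_dec _ _); try lra); reflexivity. }
  assert (Hhor : forall j, (j <= N)%nat -> (forall s, a <= s <= b -> V s (g j) <= 0) ->
    (total_turn (fun i => l i j) N = pl (l N j) - pl (l O j))%Z).
  { intros j Hj HV. apply (total_turn_potential (fun i => l i j)). intros i Hi.
    pose proof (HV _ (Hg i ltac:(lia))). pose proof (HV _ (Hg (S i) ltac:(lia))).
    unfold l, sector_of.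
    repeat (destruct (Rlt_dec _ _); try lra); reflexivity. }
  rewrite (Hvert O), (Hvert N), (Hhor O), (Hhor N) in Hgrid; try lia;
    try (intros s Hs; rewrite ?Hg0, ?HgN; specialize (HYge s Hs); unfold V; lra).
  (* The corners [(a, a)], [(b, a)], [(b, b)] are in [LowerLeft], while [(a, b)] is in [LowerRight]
     because [X a + 1 < X b]. One route has total 0 and the other 2 + 1 = 3. *)
  revert Hgrid. unfold l, sector_of. rewrite Hg0, HgN. unfold U, V.
  repeat (destruct (Rlt_dec _ _); try lra); discriminate.
Qed.

(** * Deck-equivariant maps of the plane *)

Definition equivariant (G : pt -> pt) : Prop :=
  forall z, G (deckT z) = deckT (G z).

Definition strip (M : R) (z : pt) : Prop := Rabs (snd z) <= M.

Definition disp (G : pt -> pt) (z : pt) : R := fst (G z) - fst z.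

Lemma Rabs_le_bounds (x c : R) : Rabs x <= c -> - c <= x <= c.
Proof. unfold Rabs. destruct (Rcase_abs x); lra. Qed.

Lemma dist2_lt (z w : pt) (d : R) :
  dist2 z w < d <-> Rabs (fst z - fst w) < d /\ Rabs (snd z - snd w) < d.
Proof.
  unfold dist2. split.
  - intros H. pose proof (Rmax_l (Rabs (fst z - fst w)) (Rabs (snd z - snd w))).
    pose proof (Rmax_r (Rabs (fst z - fst w)) (Rabs (snd z - snd w))). lra.
  - intros [H1 H2]. apply Rmax_lub_lt; assumption.
Qed.

Lemma disp_deckT (G : pt -> pt) (z : pt) :
  equivariant G -> disp G (deckT z) = disp G z.
Proof. intros HG. unfold disp. rewrite HG. simpl. ring. Qed.

Lemma snd_deckT (G : pt -> pt) (z : pt) :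
  equivariant G -> snd (G (deckT z)) = snd (G z).
Proof. intros HG. rewrite HG. reflexivity. Qed.

Lemma deck_reduce (Q : pt -> Prop) :
  (forall z, Q z <-> Q (deckT z)) -> (forall z, 0 <= fst z < 1 -> Q z) ->
  forall z, Q z.
Proof.
  intros HQ H01.
  assert (Hk : forall k x y, Q (x, y) <-> Q (x + INR k, y)).
  { induction k as [|k IH]; intros x y; [rewrite Rplus_0_r; reflexivity|].
    rewrite IH, HQ. unfold deckT. cbn [fst snd]. rewrite S_INR, Rplus_assoc.
    reflexivity. }
  intros [x y]. destruct (base_Int_part x) as [H1 H2].
  destruct (Z_le_gt_dec 0 (Int_part x)) as [Hp|Hp].
  - replace x with ((x - IZR (Int_part x)) + INR (Z.to_nat (Int_part x))).
    + apply Hk, H01. simpl. lra.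
    + rewrite INR_IZR_INZ, Z2Nat.id; [ring|lia].
  - apply (Hk (Z.to_nat (- Int_part x))), H01. cbn [fst].
    rewrite INR_IZR_INZ, Z2Nat.id, opp_IZR; [lra|lia].
Qed.

(** Compactness of the closed annulus covered by the strip: the fundamental domain [[0, 1] x
    [-M, M]] is compact, and deck invariance transports the radius to the rest. *)
Lemma uniform_radius_strip (M : R) (P : R -> pt -> Prop) :
  (forall d d' z, 0 < d' <= d -> P d z -> P d' z) ->
  (forall d z, P d z <-> P d (deckT z)) ->
  (forall z, exists d, 0 < d /\ forall w, dist2 w z < d -> P d w) ->
  exists d, 0 < d /\ forall z, strip M z -> P d z.
Proof.
  intros Hmono Hdeck Hloc.
  destruct (uniform_radius_2d 0 1 (- M) M (fun d x y => P d (x, y))) as [d [Hd Hz]].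
  - intros d d' x y. apply Hmono.
  - intros x y _ _. destruct (Hloc (x, y)) as [d [Hd Hw]].
    exists d; split; [exact Hd|]. intros x' y' _ _ Hx Hy.
    apply Hw, dist2_lt. split; assumption.
  - exists d; split; [exact Hd|].
    apply (deck_reduce (fun z => strip M z -> P d z)).
    + intros z. unfold strip. rewrite (Hdeck d z). reflexivity.
    + intros [x y] Hx Hy. apply Hz; simpl in *; [lra|].
      apply Rabs_le_bounds in Hy. exact Hy.
Qed.

(** The bound is written [/ d], so that a smaller [d] is a weaker claim and the uniform radius
    argument applies. *)
Lemma strip_bound (G : pt -> pt) (M : R) :
  cont2 G -> equivariant G ->
  exists B, 0 < B /\ forall z, strip M z -> strip B (G z) /\ Rabs (disp G z) <= B.
Proof.
  intros HG HT.
  destruct (uniform_radius_strip M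
    (fun d z => strip (/ d) (G z) /\ Rabs (disp G z) <= / d)) as [d [Hd Hz]].
  - intros d d' z Hd [H1 H2].
    assert (/ d <= / d') by (apply Rinv_le_contravar; lra).
    unfold strip in *. lra.
  - intros d z. unfold strip. rewrite snd_deckT, disp_deckT by exact HT. reflexivity.
  - intros z. destruct (HG z 1) as [d [Hd Hw]]; [lra|].
    (* The 2 absorbs the variation near [z]: point and image each move by less than 1, so the
       displacement changes by at most 2. *)
    set (c := Rabs (snd (G z)) + Rabs (disp G z) + 2).
    pose proof (Rabs_pos (snd (G z))). pose proof (Rabs_pos (disp G z)).
    assert (Hc : 0 < / c) by (apply Rinv_0_lt_compat; unfold c; lra).
    exists (Rmin (Rmin d 1) (/ c)).
    assert (Hpos : 0 < Rmin (Rmin d 1) (/ c)) by (repeat apply Rmin_glb_lt; lra).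
    split; [exact Hpos|]. intros w Hwz.
    pose proof (Rmin_l (Rmin d 1) (/ c)). pose proof (Rmin_r (Rmin d 1) (/ c)).
    pose proof (Rmin_l d 1). pose proof (Rmin_r d 1).
    assert (Hcle : c <= / Rmin (Rmin d 1) (/ c)).
    { rewrite <- (Rinv_inv c) at 1. apply Rinv_le_contravar; assumption. }
    destruct (proj1 (dist2_lt _ _ _) (Hw w ltac:(lra))) as [Ex Ey].
    destruct (proj1 (dist2_lt _ _ _) Hwz) as [Ew _].
    unfold strip, disp in *.
    split; (eapply Rle_trans; [|exact Hcle]); unfold c.
    + replace (snd (G w)) with (snd (G z) + (snd (G w) - snd (G z))) by ring.
      eapply Rle_trans; [apply Rabs_triang|]. lra.
    + replace (fst (G w) - fst w) with
        ((fst (G z) - fst z) + ((fst (G w) - fst (G z)) - (fst w - fst z))) by ring.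
      eapply Rle_trans; [apply Rabs_triang|].
      assert (Rabs (fst (G w) - fst (G z) - (fst w - fst z)) <= 2); [|lra].
      apply Rabs_def2 in Ex, Ew. apply Rabs_le. lra.
  - exists (/ d). split; [apply Rinv_0_lt_compat, Hd|exact Hz].
Qed.

(** * Straight segments and their images *)

Definition segment (z w : pt) (s : R) : pt :=
  (fst z + s * (fst w - fst z), snd z + s * (snd w - snd z)).

Lemma segment_0 (z w : pt) : segment z w 0 = z.
Proof. destruct z, w; unfold segment; simpl; f_equal; ring. Qed.

Lemma segment_1 (z w : pt) : segment z w 1 = w.
Proof. destruct z, w; unfold segment; simpl; f_equal; ring. Qed.

Lemma continuity_segment (G : pt -> pt) (z w : pt) :
  cont2 G ->
  continuity (fun s => fst (G (segment z w s))) /\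
  continuity (fun s => snd (G (segment z w s))).
Proof.
  intros HG.
  assert (H : forall s eps, 0 < eps -> exists d, 0 < d /\ forall s', Rabs (s' - s) < d ->
    dist2 (G (segment z w s')) (G (segment z w s)) < eps).
  { intros s eps Heps. destruct (HG (segment z w s) eps Heps) as [d [Hd Hw]].
    set (c := Rabs (fst w - fst z) + Rabs (snd w - snd z) + 1).
    pose proof (Rabs_pos (fst w - fst z)). pose proof (Rabs_pos (snd w - snd z)).
    assert (Hc : 0 < c) by (unfold c; lra).
    exists (d / c). split; [apply Rdiv_lt_0_compat; assumption|].
    intros s' Hs'. apply Hw, dist2_lt. unfold segment. cbn [fst snd].
    assert (Hm : Rabs (s' - s) * c < d).
    { apply (Rmult_lt_compat_r c) in Hs'; [|exact Hc].
      replace (d / c * c) with d in Hs' by (field; lra). exact Hs'. }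
    pose proof (Rabs_pos (s' - s)).
    split.
    - replace (_ - _) with ((s' - s) * (fst w - fst z)) by ring.
      rewrite Rabs_mult. unfold c in Hm. nra.
    - replace (_ - _) with ((s' - s) * (snd w - snd z)) by ring.
      rewrite Rabs_mult. unfold c in Hm. nra. }
  split; apply continuity_of_eps; intros s eps Heps;
    destruct (H s eps Heps) as [d [Hd Hs]]; exists d; (split; [exact Hd|]);
    intros s' Hs'; apply (proj1 (dist2_lt _ _ _) (Hs s' Hs')).
Qed.

Lemma segment_between (c d : R) (x y s : R) :
  c <= x <= d -> c <= y <= d -> 0 <= s <= 1 -> c <= x + s * (y - x) <= d.
Proof. intros; nra. Qed.

Lemma segment_strip (M : R) (z w : pt) (s : R) :
  strip M z -> strip M w -> 0 <= s <= 1 -> strip M (segment z w s).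
Proof.
  unfold strip. intros Hz Hw Hs. apply Rabs_le_bounds in Hz, Hw.
  apply Rabs_le, segment_between; assumption.
Qed.

Lemma strip_representative (G : pt -> pt) (z : pt) :
  equivariant G ->
  exists w, 0 <= fst w < 1 /\ snd w = snd z /\ snd (G w) = snd (G z) /\
    disp G w = disp G z.
Proof.
  intros HT. revert z. apply deck_reduce.
  - intros z. rewrite snd_deckT, disp_deckT by exact HT. reflexivity.
  - intros z Hz. exists z. repeat split; try reflexivity; apply Hz.
Qed.

(* The image of a segment joining two returning points is disjoint from its
   unit translate; if it skipped a gap, a subarc of it would jump over the strip
   on one side, and [unit_chord_half_plane] would make it meet its translate. *)
Lemma displacement_gap (G : pt -> pt) (M a b : R) (z z' : pt) :
  cont2 G -> (forall u v, G u = G v -> u = v) -> equivariant G ->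
  strip M z -> strip M (G z) -> b <= disp G z ->
  strip M z' -> strip M (G z') -> disp G z' <= a ->
  a + 2 < b ->
  exists w, strip M w /\ strip M (G w) /\ a < disp G w < b.
Proof.
  intros HG Hinj HT Hz HGz Hb Hz' HGz' Ha Hab.
  apply NNPP; intros Hno.
  destruct (strip_representative G z HT) as [u [Hu [Eu [EGu Du]]]].
  destruct (strip_representative G z' HT) as [u' [Hu' [Eu' [EGu' Du']]]].
  unfold strip in Hz, HGz, Hz', HGz'.
  rewrite <- Eu in Hz. rewrite <- EGu in HGz. rewrite <- Du in Hb.
  rewrite <- Eu' in Hz'. rewrite <- EGu' in HGz'. rewrite <- Du' in Ha.
  clear z z' Eu EGu Du Eu' EGu' Du'.
  set (c := segment u u').
  set (X := fun s => fst (G (c s))). set (Y := fun s => snd (G (c s))).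
  destruct (continuity_segment G u u' HG) as [HX HY].
  change (continuity X) in HX. change (continuity Y) in HY.
  (* Both endpoints were moved into the fundamental domain, so the segment never meets its unit
     translate. *)
  assert (Hc1 : forall s, 0 <= s <= 1 -> 0 <= fst (c s) < 1).
  { intros s Hs. unfold c, segment. cbn [fst].
    pose proof (Rmax_l (fst u) (fst u')). pose proof (Rmax_r (fst u) (fst u')).
    pose proof (Rmax_lub_lt (fst u) (fst u') 1 (proj2 Hu) (proj2 Hu')).
    pose proof (segment_between 0 (Rmax (fst u) (fst u')) (fst u) (fst u') s
      ltac:(lra) ltac:(lra) Hs). lra. }
  assert (HcM : forall s, 0 <= s <= 1 -> strip M (c s)).
  { intros s Hs. apply segment_strip; assumption. }
  assert (Hc0 : c 0 = u) by apply segment_0.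
  assert (Hc1' : c 1 = u') by apply segment_1.
  assert (Hchord : forall s t, 0 <= s <= 1 -> 0 <= t <= 1 ->
    X t = X s + 1 -> Y t = Y s -> False).
  { intros s t Hs Ht EX EY.
    assert (E : c t = deckT (c s)).
    { apply Hinj. rewrite HT. apply injective_projections; assumption. }
    apply (f_equal fst) in E. unfold deckT in E; cbn [fst] in E.
    pose proof (Hc1 s Hs). pose proof (Hc1 t Ht). lra. }
  set (inside := fun s => (0 <= s /\ s <= 1) /\ (- M <= Y s /\ Y s <= M)).
  (* As [fst (c s)] lies in [[0, 1)], a value of [X s] strictly between [a + 1] and [b] would give a
     displacement in the forbidden gap. *)
  assert (Hsplit : forall s, inside s -> X s <= a + 1 \/ b <= X s).
  { intros s [Hs HYs].
    destruct (Rle_dec (X s) (a + 1)) as [|H1]; [left; assumption|].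
    destruct (Rle_dec b (X s)) as [|H2]; [right; assumption|].
    exfalso; apply Hno. exists (c s). pose proof (Hc1 s Hs).
    split; [apply HcM, Hs|]. split; [apply Rabs_le; exact HYs|].
    unfold disp. fold (X s). lra. }
  assert (Hid : continuity (fun s => s)) by (apply derivable_continuous, derivable_id).
  assert (Hcl : closed_set inside).
  { repeat apply closed_set_and; try apply closed_set_le; try apply closed_set_ge;
      assumption. }
  (* [s0] is the last time in the strip on the right of the gap, and [s1] the first later time in
     the strip on its left; in between, the path is outside the strip. *)
  destruct (closed_set_max (fun s => inside s /\ b <= X s) 1) as [s0 [[Is0 Xs0] Hmax]].
  { apply closed_set_and; [exact Hcl|apply closed_set_ge, HX]. }
  { exists 0. unfold inside, X, Y. rewrite Hc0. apply Rabs_le_bounds in HGz.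
    unfold disp in Hb. lra. }
  { intros s [Hs _]. apply Hs. }
  destruct (closed_set_min (fun s => (inside s /\ X s <= a + 1) /\ s0 <= s) 0)
    as [s1 [[[Is1 Xs1] Hs01] Hmin]].
  { repeat apply closed_set_and; try apply closed_set_le; try apply closed_set_ge;
      assumption. }
  { exists 1. unfold inside, X, Y. rewrite Hc1'. apply Rabs_le_bounds in HGz'.
    unfold disp in Ha. destruct Is0. lra. }
  { intros s [[Hs _] _]. apply Hs. }
  assert (Hlt : s0 < s1) by (destruct (Req_dec s0 s1) as [E|]; [rewrite E in *|]; lra).
  assert (Hout : forall s, s0 < s < s1 -> ~ (- M <= Y s <= M)).
  { intros s Hs HYs.
    assert (Is : inside s) by (destruct Is0, Is1; split; [lra|exact HYs]).
    destruct (Hsplit s Is) as [H|H].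
    - assert (s1 <= s); [apply Hmin; repeat split; try apply Is; lra|lra].
    - assert (s <= s0); [apply Hmax; split; assumption|lra]. }
  assert (HM : 0 <= M) by (pose proof (Rabs_pos (snd u)); lra).
  (* [e] is the side, above or below the strip, on which the path jumps *)
  assert (Hjump : forall e, e * e = 1 -> M < e * Y ((s0 + s1) / 2) -> False).
  { intros e He Hmid.
    assert (HeY : continuity (fun s => e * Y s)) by (apply (continuity_scal Y e), HY).
    assert (HeM : forall y, - M <= e * y <= M -> - M <= y <= M).
    { intros y Hy. assert (e = 1 \/ e = -1) as [->| ->] by nra; lra. }
    assert (HMe : forall y, - M <= y <= M -> - M <= e * y <= M).
    { intros y Hy. assert (e = 1 \/ e = -1) as [->| ->] by nra; lra. }
    assert (Habove : forall s, s0 < s < s1 -> M < e * Y s).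
    { intros s Hs. apply Rnot_le_lt; intros Hle.
      destruct (Rle_dec s ((s0 + s1) / 2)) as [Hsm|Hsm].
      - destruct (IVT_value _ s ((s0 + s1) / 2) M HeY) as [r [Hr Er]]; [lra|lra|].
        apply (Hout r); [lra|]. apply HeM. lra.
      - destruct (IVT_value _ ((s0 + s1) / 2) s M HeY) as [r [Hr Er]]; [lra|lra|].
        apply (Hout r); [lra|]. apply HeM. lra. }
    (* By continuity from the open arc; since the endpoints are also in the strip, both have height
       exactly [M]. *)
    assert (Hend : forall r, r = s0 \/ r = s1 -> M <= e * Y r).
    { intros r Hr. apply Rnot_lt_le; intros Hl.
      destruct (continuity_lt_near _ r M HeY Hl) as [d [Hd Hy]].
      set (k := Rmin (d / 2) ((s1 - s0) / 2)).
      assert (0 < k) by (apply Rmin_glb_lt; lra).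
      assert (k <= d / 2) by apply Rmin_l.
      assert (k <= (s1 - s0) / 2) by apply Rmin_r.
      destruct Hr as [-> | ->].
      - pose proof (Habove (s0 + k) ltac:(lra)).
        assert (e * Y (s0 + k) < M) by (apply Hy, Rabs_def1; lra). lra.
      - pose proof (Habove (s1 - k) ltac:(lra)).
        assert (e * Y (s1 - k) < M) by (apply Hy, Rabs_def1; lra). lra. }
    destruct Is0 as [H0 HY0]. destruct Is1 as [H1 HY1].
    pose proof (HMe _ HY0). pose proof (HMe _ HY1).
    pose proof (Hend s0 (or_introl eq_refl)). pose proof (Hend s1 (or_intror eq_refl)).
    assert (Hneg : forall f, continuity f -> continuity (fun s => f (- s))).
    { intros f Hf. apply (continuity_comp (fun s => - s) f); [|exact Hf].
      apply (continuity_opp (fun s => s)), Hid. }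
    (* Time is reversed because [X] decreases from [s0] to [s1]; the drop is at least [b - a - 1],
       which exceeds 1. *)
    destruct (unit_chord_half_plane (fun s => X (- s)) (fun s => e * Y (- s)) (- s1) (- s0))
      as [s [t [Hs [Ht [EX EY]]]]].
    - apply Hneg, HX.
    - apply (Hneg (fun s => e * Y s)), HeY.
    - lra.
    - intros s Hs. rewrite Ropp_involutive.
      destruct (Req_dec s (- s1)) as [->|N1]; [rewrite Ropp_involutive; lra|].
      destruct (Req_dec s (- s0)) as [->|N0]; [rewrite Ropp_involutive; lra|].
      pose proof (Habove (- s) ltac:(lra)). lra.
    - rewrite !Ropp_involutive. lra.
    - rewrite !Ropp_involutive. lra.
    - apply (Hchord (- s) (- t)); [lra|lra|exact EX|].
      assert (e <> 0) by (intros ->; lra). apply (Rmult_eq_reg_l e); assumption. }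
  pose proof (Hout ((s0 + s1) / 2) ltac:(lra)) as Hmid.
  destruct (Rlt_dec M (Y ((s0 + s1) / 2))).
  - apply (Hjump 1); lra.
  - apply (Hjump (-1)); lra.
Qed.

(** * Iterates and inverses *)

Lemma homeo2_iter (F : pt -> pt) (n : nat) : homeo2 F -> homeo2 (Nat.iter n F).
Proof.
  intros [HF [g [Hg [HgF HFg]]]]. induction n as [|n [Hn [h [Hh [HhF HFh]]]]].
  - split; [|exists (fun z => z); repeat split];
      intros z eps Heps; exists eps; split; auto.
  - assert (Hcomp : forall f1 f2, cont2 f1 -> cont2 f2 -> cont2 (fun z => f1 (f2 z))).
    { intros f1 f2 H1 H2 z eps Heps. destruct (H1 (f2 z) eps Heps) as [d [Hd Hw]].
      destruct (H2 z d Hd) as [d' [Hd' Hw']]. exists d'; auto. }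
    split; [apply (Hcomp F), Hn; exact HF|].
    exists (fun z => h (g z)). split; [apply Hcomp; assumption|]. split.
    + intros z. rewrite Nat.iter_succ, HgF. apply HhF.
    + intros z. rewrite Nat.iter_succ, HFh. apply HFg.
Qed.

Lemma equivariant_iter (F : pt -> pt) (n : nat) :
  equivariant F -> equivariant (Nat.iter n F).
Proof.
  intros HT. induction n as [|n IH]; intros z; [reflexivity|].
  rewrite !Nat.iter_succ, IH. apply HT.
Qed.

Lemma equivariant_inverse (F g : pt -> pt) :
  equivariant F -> (forall z, g (F z) = z) -> (forall z, F (g z) = z) -> equivariant g.
Proof. intros HT HgF HFg z. rewrite <- (HFg z) at 1. rewrite <- HT. apply HgF. Qed.

(** * Isotopies preserve the ends of the annulus *)

(** Let [B] bound the heights of the preimage of [strip 2] under [H t0], and let [H t] be 1-close to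
    [H t0] on [strip (B + 1)]. Closeness is known only there, so a far point sent to level 0 is
    connected back: a segment inside [strip 1] pulls back to a path crossing height [B + 1], at a
    point that [H t0] sends into [strip 2], which is absurd. *)
Lemma isotopy_avoids_level_locally (H : R -> pt -> pt) (t0 : R) :
  lifted_isotopy H -> 0 <= t0 <= 1 ->
  exists d, 0 < d /\ forall t, 0 <= t <= 1 -> Rabs (t - t0) < d ->
    forall z, / d <= Rabs (snd z) -> snd (H t z) <> 0.
Proof.
  intros [Hcont [_ [Hhom HT]]] Ht0.
  destruct (Hhom t0 Ht0) as [Hc0 [g [Hg [HgH HHg]]]].
  assert (Tg : equivariant g).
  { apply (equivariant_inverse (H t0)); [intros z; apply HT, Ht0|assumption|assumption]. }
  destruct (strip_bound g 2 Hg Tg) as [B [HB HgB]].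
  destruct (uniform_radius_strip (B + 1) (fun d z => forall t, 0 <= t <= 1 ->
    Rabs (t - t0) < d -> dist2 (H t z) (H t0 z) < 1)) as [d [Hd Hclose]].
  { intros d d' z Hd Hz t Ht Htd. apply Hz; [exact Ht|lra]. }
  { intros d z. split; intros Hz t Ht Htd; specialize (Hz t Ht Htd);
      apply dist2_lt; apply dist2_lt in Hz;
      rewrite !HT in * by assumption; cbn [deckT fst snd] in *;
      (split; [|apply Hz]); destruct Hz as [Hz _];
      [replace (_ - _) with (fst (H t z) - fst (H t0 z)) by ring; exact Hz|].
    replace (fst (H t z) + 1 - (fst (H t0 z) + 1))
      with (fst (H t z) - fst (H t0 z)) in Hz by ring; exact Hz. }
  { intros z. destruct (Hcont t0 z (1 / 2) Ht0) as [d [Hd Hw]]; [lra|].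
    exists d; split; [exact Hd|]. intros w Hwz t Ht Htd.
    pose proof (Hw t w Ht Htd Hwz) as H1.
    pose proof (Hw t0 w Ht0 ltac:(rewrite Rminus_diag, Rabs_R0; exact Hd) Hwz) as H2.
    apply dist2_lt in H1, H2. apply dist2_lt.
    destruct H1 as [H1 H1'], H2 as [H2 H2']. apply Rabs_def2 in H1, H1', H2, H2'.
    split; apply Rabs_def1; lra. }
  exists (Rmin d (/ (B + 1))).
  assert (HB1 : 0 < / (B + 1)) by (apply Rinv_0_lt_compat; lra).
  assert (Hm : 0 < Rmin d (/ (B + 1))) by (apply Rmin_glb_lt; assumption).
  split; [exact Hm|]. intros t Ht Htd z Hz E.
  pose proof (Rmin_l d (/ (B + 1))). pose proof (Rmin_r d (/ (B + 1))).
  assert (HzB : B + 1 <= Rabs (snd z)).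
  { apply (Rle_trans _ (/ Rmin d (/ (B + 1)))); [|exact Hz].
    rewrite <- (Rinv_inv (B + 1)) at 1. apply Rinv_le_contravar; assumption. }
  destruct (Hhom t Ht) as [_ [h [Hh [HhH HHh]]]].
  (* A base point within [strip B] whose image under [H t] is still in [strip 1]; the segment starts
     from that image. *)
  set (w0 := g (0, 0)).
  assert (Hw0 : strip B w0).
  { apply HgB. unfold strip; simpl. rewrite Rabs_R0. lra. }
  assert (Hnear : forall w, strip (B + 1) w -> Rabs (snd (H t w) - snd (H t0 w)) < 1).
  { intros w Hw. apply dist2_lt, Hclose; [exact Hw|exact Ht|lra]. }
  assert (Hq0 : strip 1 (H t w0)).
  { unfold strip in *. pose proof (Hnear w0 ltac:(unfold strip; lra)) as Hn.
    unfold w0 in *. rewrite HHg in Hn. simpl in Hn. rewrite Rminus_0_r in Hn. lra. }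
  assert (Hp : strip 1 (H t z)).
  { unfold strip. rewrite E, Rabs_R0. lra. }
  set (p := segment (H t w0) (H t z)).
  assert (Hcross : exists s, 0 <= s <= 1 /\ Rabs (snd (h (p s))) = B + 1).
  { destruct (continuity_segment h (H t w0) (H t z) Hh) as [_ HY].
    fold p in HY. unfold strip in Hw0. apply Rabs_le_bounds in Hw0.
    assert (Hp0 : snd (h (p 0)) = snd w0)
      by (unfold p; rewrite segment_0, HhH; reflexivity).
    assert (Hp1 : snd (h (p 1)) = snd z)
      by (unfold p; rewrite segment_1, HhH; reflexivity).
    destruct (Rle_dec 0 (snd z)) as [Hpos|Hneg].
    - rewrite Rabs_pos_eq in HzB by exact Hpos.
      destruct (IVT_value _ 0 1 (B + 1) HY) as [s [Hs Es]]; [lra|left; lra|].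
      exists s; split; [exact Hs|]. rewrite Es. apply Rabs_pos_eq; lra.
    - rewrite Rabs_left in HzB by lra.
      destruct (IVT_value _ 0 1 (- (B + 1)) HY) as [s [Hs Es]]; [lra|right; lra|].
      exists s; split; [exact Hs|]. rewrite Es, Rabs_Ropp. apply Rabs_pos_eq; lra. }
  destruct Hcross as [s [Hs Es]].
  pose proof (Hnear (h (p s)) ltac:(unfold strip; lra)) as Hn. rewrite HHh in Hn.
  pose proof (segment_strip 1 _ _ s Hq0 Hp Hs) as Hps. fold p in Hps.
  unfold strip in Hps. apply Rabs_le_bounds in Hps. apply Rabs_def2 in Hn.
  destruct (HgB (H t0 (h (p s)))) as [Hbad _]; [apply Rabs_le; lra|].
  rewrite HgH in Hbad. unfold strip in Hbad. lra.
Qed.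

(* Here and below [c] is 1 or -1 and [c * snd z] is the height of [z], measured
   upwards or downwards, so that both ends are treated at once. *)
Definition bounded_below (c : R) (G : pt -> pt) : Prop :=
  forall A, exists B, forall z, A <= c * snd z -> B <= c * snd (G z).

(** By compactness of the time interval, points beyond a fixed height never cross level 0 during the
    isotopy and so keep their side; the remaining points lie in a strip, whose image is bounded. *)
Lemma isotopy_bounded_below (H : R -> pt -> pt) (c : R) :
  lifted_isotopy H -> c = 1 \/ c = -1 -> bounded_below c (H 1).
Proof.
  intros HH Hc A.
  destruct (uniform_radius_1d 0 1 (fun d t => forall z, / d <= Rabs (snd z) ->
    snd (H t z) <> 0)) as [d [Hd Hlev]].
  { intros d d' t Hd Ht z Hz. apply Ht.
    assert (/ d <= / d') by (apply Rinv_le_contravar; lra). lra. }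
  { intros t Ht. exact (isotopy_avoids_level_locally H t HH Ht). }
  destruct HH as [Hcont [H0 [Hhom HT]]].
  destruct (strip_bound (H 1) (Rmax (/ d) (Rabs A))) as [B [HB Hstrip]].
  { apply Hhom; lra. }
  { intros z; apply HT; lra. }
  exists (- B). intros z Hz.
  destruct (Rle_dec (Rabs (snd z)) (Rmax (/ d) (Rabs A))) as [Hin|Hout].
  { destruct (Hstrip z Hin) as [Hs _]. unfold strip in Hs.
    apply Rabs_le_bounds in Hs. destruct Hc as [->| ->]; lra. }
  pose proof (Rmax_l (/ d) (Rabs A)). pose proof (Rmax_r (/ d) (Rabs A)).
  pose proof (Rinv_0_lt_compat d Hd).
  assert (Hpos : 0 < c * snd z).
  { revert Hout Hz. pose proof (Rle_abs (- A)) as HA. rewrite Rabs_Ropp in HA.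
    unfold Rabs at 1. destruct (Rcase_abs (snd z)); destruct Hc as [->| ->]; lra. }
  apply Rnot_lt_le; intros Hneg.
  (* Extends the trajectory of [z] to a continuous function on the whole line, as the intermediate
     value lemma requires. *)
  set (clamp := fun t => Rmax 0 (Rmin 1 t)).
  assert (Hclamp : forall t, 0 <= clamp t <= 1).
  { intros t. unfold clamp, Rmax, Rmin.
    destruct (Rle_dec 1 t); destruct (Rle_dec 0 _); lra. }
  assert (Hlip : forall s t, Rabs (clamp s - clamp t) <= Rabs (s - t)).
  { intros s t. unfold clamp, Rmax, Rmin, Rabs.
    destruct (Rle_dec 1 t); destruct (Rle_dec 1 s);
    repeat destruct (Rle_dec 0 _); repeat destruct (Rcase_abs _); lra. }
  assert (Hpath : continuity (fun t => c * snd (H (clamp t) z))).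
  { apply (continuity_scal (fun t => snd (H (clamp t) z)) c), continuity_of_eps.
    intros t eps Heps.
    destruct (Hcont (clamp t) z eps (Hclamp t) Heps) as [d' [Hd' Hs]].
    exists d'; split; [exact Hd'|]. intros s Hst.
    apply dist2_lt, Hs; [apply Hclamp| |].
    - pose proof (Hlip s t). lra.
    - apply dist2_lt. rewrite !Rminus_diag, Rabs_R0. split; exact Hd'. }
  assert (C0 : clamp 0 = 0) by (unfold clamp; rewrite Rmin_right, Rmax_left; lra).
  assert (C1 : clamp 1 = 1) by (unfold clamp; rewrite Rmin_left, Rmax_right; lra).
  destruct (IVT_value _ 0 1 0 Hpath) as [t [Ht Et]]; [lra| |].
  - right. rewrite C0, C1, H0. lra.
  - apply (Hlev (clamp t) (Hclamp t) z); [lra|].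
    destruct Hc as [->| ->]; lra.
Qed.

(** * Pushing the strip off itself *)

Definition pushes_off (c : R) (G : pt -> pt) (M : R) : Prop :=
  forall z, - M <= c * snd z -> M < c * snd (G z).

Lemma height_strip (c M : R) (z : pt) :
  c = 1 \/ c = -1 -> strip M z <-> - M <= c * snd z <= M.
Proof.
  intros Hc. unfold strip. split.
  - intros Hz. apply Rabs_le_bounds in Hz. destruct Hc as [->| ->]; lra.
  - intros Hz. apply Rabs_le. destruct Hc as [->| ->]; lra.
Qed.

(** The strip is connected, so its image is wholly on the side to which the origin goes. A point
    beyond the strip cannot land at or below level [M]: going down from its image, the preimage
    would cross the strip at a point whose image is too low. *)
Lemma no_return_pushes_off (c : R) (G : pt -> pt) (M : R) :
  c = 1 \/ c = -1 -> homeo2 G -> bounded_below c G -> 0 <= M ->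
  (forall z, strip M z -> ~ strip M (G z)) ->
  M < c * snd (G (0, 0)) ->
  pushes_off c G M.
Proof.
  intros Hc [HG [g [Hg [HgG HGg]]]] Hbb HM Hno H0.
  assert (Hin : forall z, strip M z -> M < c * snd (G z)).
  { intros z Hz. apply Rnot_le_lt; intros Hle.
    destruct (continuity_segment G (0, 0) z HG) as [_ HY].
    apply (continuity_scal _ c) in HY. unfold mult_real_fct in HY.
    destruct (IVT_value _ 0 1 M HY) as [s [Hs Es]]; [lra| |].
    { rewrite segment_0, segment_1. right; lra. }
    apply (Hno (segment (0, 0) z s)).
    - apply segment_strip; [|exact Hz|exact Hs].
      unfold strip; simpl. rewrite Rabs_R0. exact HM.
    - apply (height_strip c); [exact Hc|lra]. }
  intros z Hz. destruct (Rle_dec (c * snd z) M) as [Hle|Hgt].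
  { apply Hin, (height_strip c); [exact Hc|lra]. }
  apply Rnot_le_lt; intros Hle.
  destruct (Hbb M) as [B HB].
  (* a vertical segment going down from [G z] to a point whose preimage lies
     below level [M] *)
  set (w := (fst (G z), Rmin (c * snd (G z)) (B - 1) * c)).
  pose proof (Rmin_l (c * snd (G z)) (B - 1)).
  pose proof (Rmin_r (c * snd (G z)) (B - 1)).
  assert (Hw : c * snd w = Rmin (c * snd (G z)) (B - 1)).
  { unfold w; cbn [snd]. destruct Hc as [->| ->]; ring. }
  destruct (continuity_segment g (G z) w Hg) as [_ HY].
  apply (continuity_scal _ c) in HY. unfold mult_real_fct in HY.
  assert (Hend : c * snd (g w) < M).
  { apply Rnot_le_lt; intros Hge. specialize (HB _ Hge). rewrite HGg in HB. lra. }
  destruct (IVT_value _ 0 1 M HY) as [s [Hs Es]]; [lra| |].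
  { rewrite segment_0, segment_1, HgG. right; lra. }
  assert (Hbad : M < c * snd (G (g (segment (G z) w s)))).
  { apply Hin, (height_strip c); [exact Hc|lra]. }
  rewrite HGg in Hbad. unfold segment in Hbad. cbn [snd] in Hbad.
  replace (c * (snd (G z) + s * (snd w - snd (G z))))
    with (c * snd (G z) + s * (c * snd w - c * snd (G z))) in Hbad by ring.
  nra.
Qed.

Lemma pushes_off_mul (c : R) (F : pt -> pt) (M : R) (n k : nat) :
  0 <= M -> pushes_off c (Nat.iter n F) M -> (1 <= k)%nat ->
  pushes_off c (Nat.iter (k * n) F) M.
Proof.
  intros HM Hn Hk. induction Hk as [|k Hk IH]; [rewrite Nat.mul_1_l; exact Hn|].
  intros z Hz. change (S k * n)%nat with (n + k * n)%nat. rewrite Nat.iter_add.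
  apply Hn. specialize (IH z Hz). lra.
Qed.

Lemma bounded_below_finite (c : R) (F : pt -> pt) (M : R) (n : nat) :
  bounded_below c F ->
  exists B, M <= B /\ forall j z, (j < n)%nat -> M <= c * snd z ->
    - B <= c * snd (Nat.iter j F z).
Proof.
  intros Hbb.
  assert (Hj : forall j, exists B, forall z, M <= c * snd z -> B <= c * snd (Nat.iter j F z)).
  { induction j as [|j [B HB]]; [exists M; auto|].
    destruct (Hbb B) as [B' HB']. exists B'. intros z Hz. apply HB', HB, Hz. }
  induction n as [|n [B [HMB HB]]]; [exists M; split; [lra|intros; lia]|].
  destruct (Hj n) as [B' HB'].
  exists (Rmax B (- B')). pose proof (Rmax_l B (- B')). pose proof (Rmax_r B (- B')).
  split; [lra|]. intros j z Hjn Hz. destruct (Nat.eq_dec j n) as [->|Hne].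
  - specialize (HB' z Hz). lra.
  - specialize (HB j z ltac:(lia) Hz). lra.
Qed.

(* Pushing a larger strip in the opposite direction is impossible, since the
   times n1 and n2 have a common multiple; pushing it in the same direction
   sends the whole future of the small strip beyond it. *)
Lemma pushed_off_never_returns (c : R) (F : pt -> pt) (M : R) (n1 : nat) :
  c = 1 \/ c = -1 -> bounded_below c F -> 0 <= M -> (1 <= n1)%nat ->
  pushes_off c (Nat.iter n1 F) M ->
  (forall M', M <= M' -> exists n, (1 <= n)%nat /\
     (pushes_off c (Nat.iter n F) M' \/ pushes_off (- c) (Nat.iter n F) M')) ->
  exists k0, forall k z, (k0 <= k)%nat -> strip M z -> ~ strip M (Nat.iter k F z).
Proof.
  intros Hc Hbb HM Hn1 Hp1 Hpush.
  destruct (bounded_below_finite c F M n1 Hbb) as [M' [HMM' Hfin]].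
  (* Every [n1] steps the orbit is back above [M], and between two such times it cannot go below
     [- M']. *)
  assert (Hall : forall k z, M <= c * snd z -> - M' <= c * snd (Nat.iter k F z)).
  { induction k as [k IH] using lt_wf_ind. intros z Hz.
    destruct (Nat.lt_ge_cases k n1) as [Hk|Hk]; [apply Hfin; assumption|].
    replace k with ((k - n1) + n1)%nat by lia. rewrite Nat.iter_add.
    apply IH; [lia|]. assert (M < c * snd (Nat.iter n1 F z)); [apply Hp1|]; lra. }
  destruct (Hpush M' HMM') as [n2 [Hn2 [Hp2|Hp2]]].
  - exists (n1 + n2)%nat. intros k z Hk Hz Hret.
    apply (height_strip c) in Hz, Hret; try exact Hc.
    (* The first [n1] steps lift the point above [M], the middle ones keep it above [- M'], and the
       last [n2] send it beyond [M']. *)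
    revert Hret. replace k with (n2 + ((k - n1 - n2) + n1))%nat by lia.
    rewrite !Nat.iter_add. intros Hret.
    assert (M' < c * snd (Nat.iter n2 F (Nat.iter (k - n1 - n2) F (Nat.iter n1 F z)))).
    { apply Hp2, Hall. assert (M < c * snd (Nat.iter n1 F z)); [apply Hp1|]; lra. }
    lra.
  - exfalso.
    pose proof (pushes_off_mul c F M n1 n2 HM Hp1 Hn2 (0, 0)) as H1.
    pose proof (pushes_off_mul (- c) F M' n2 n1 ltac:(lra) Hp2 Hn1 (0, 0)) as H2.
    rewrite Nat.mul_comm in H2. cbn [snd] in H1, H2. lra.
Qed.

(** * Times without return *)

Definition returns (F : pt -> pt) (M : R) (n : nat) (z : pt) : Prop :=
  strip M z /\ strip M (Nat.iter n F z).

Lemma compact_strip (M : R) : compact_annulus (strip M).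
Proof.
  split; [intros z; reflexivity|]. split.
  - intros z Hz. unfold strip in *. exists (Rabs (snd z) - M). split; [lra|].
    intros w Hw Hws. apply dist2_lt in Hw. destruct Hw as [_ Hw].
    rewrite Rabs_minus_sym in Hw.
    pose proof (Rabs_triang_inv (snd z) (snd w)). lra.
  - exists M. intros z Hz. exact Hz.
Qed.

(** The displacement is [n] times [rho_n], so a neighbourhood of 0 avoided by [rho_n] becomes a
    linear lower bound on the displacement. *)
Lemma not_in_rho_strip_0 (F : pt -> pt) (M : R) :
  ~ in_rho_K F (strip M) 0 ->
  exists m eps, 0 < eps /\ forall n z, (1 <= n)%nat -> (m <= n)%nat -> returns F M n z ->
    eps * INR n <= Rabs (disp (Nat.iter n F) z).
Proof.
  intros Hno. apply NNPP; intros Hn. apply Hno. intros m eps Heps.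
  apply NNPP; intros Hn'. apply Hn. exists m, eps. split; [exact Heps|].
  intros n z H1 Hm [Hz HFz]. apply Rnot_lt_le; intros Hlt. apply Hn'.
  exists n, z. repeat split; try assumption.
  assert (0 < INR n) by (apply lt_0_INR; lia).
  rewrite Rminus_0_r. unfold rho_n, p1. fold (disp (Nat.iter n F) z).
  unfold Rdiv. rewrite Rabs_mult, Rabs_inv, (Rabs_pos_eq (INR n)) by lra.
  apply (Rmult_lt_reg_r (INR n)); [assumption|].
  rewrite Rmult_assoc, Rinv_l, Rmult_1_r; lra.
Qed.

(* If the strip returned at all large times, then, the displacements having no
   gap around 0, all returns at a given time would turn the same way, and this
   way could not change from one time to the next. *)
Lemma exists_time_without_return (F : pt -> pt) (M0 M : R) :
  homeo2 F -> equivariant F -> (forall M, ~ in_rho_K F (strip M) 0) ->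
  (forall m, exists n z, (m <= n)%nat /\ returns F M0 n z /\ 0 < disp (Nat.iter n F) z) ->
  (forall m, exists n z, (m <= n)%nat /\ returns F M0 n z /\ disp (Nat.iter n F) z < 0) ->
  M0 <= M ->
  exists n, (1 <= n)%nat /\ forall z, strip M z -> ~ strip M (Nat.iter n F z).
Proof.
  intros HF HT Hrho Hplus Hminus HM0. apply NNPP; intros Hn.
  assert (Hret : forall n, (1 <= n)%nat -> exists z, returns F M n z).
  { intros n Hn1. apply NNPP; intros Hno. apply Hn. exists n. split; [exact Hn1|].
    intros z Hz HFz. apply Hno. exists z. split; assumption. }
  destruct (strip_bound F M (proj1 HF) HT) as [B [HB HFB]].
  (* The larger strip contains the image of [strip M] under [F], so a return to [strip M] at time
     [n] is still a return to [strip M'] at time [n + 1]. *)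
  set (M' := Rmax M B).
  assert (HMM' : M <= M') by apply Rmax_l. assert (HBM' : B <= M') by apply Rmax_r.
  destruct (not_in_rho_strip_0 F M' (Hrho M')) as [m [eps [Heps Hfar]]].
  assert (Hmono : forall M1 n z, M1 <= M' -> returns F M1 n z -> returns F M' n z).
  { intros M1 n z HM1 [H1 H2]. unfold returns, strip in *. lra. }
  (* From [n0] on, [eps * INR n] exceeds the displacement [B] of one step, and the interval of
     forbidden displacements around 0 is longer than 2. *)
  destruct (INR_unbounded ((B + 2) / eps)) as [n0 Hn0].
  assert (Hbig : forall n, (n0 <= n)%nat -> B + 2 < eps * INR n).
  { intros n Hle. apply le_INR in Hle.
    apply (Rmult_lt_compat_l eps) in Hn0; [|exact Heps].
    replace (eps * ((B + 2) / eps)) with (B + 2) in Hn0 by (field; lra). nra. }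
  set (N := (S (n0 + m))).
  assert (Hsame : forall n z z', (N <= n)%nat -> returns F M' n z -> returns F M' n z' ->
    0 < disp (Nat.iter n F) z -> disp (Nat.iter n F) z' < 0 -> False).
  { intros n z z' HNn Hz Hz' Hd Hd'.
    pose proof (Hbig n ltac:(lia)).
    pose proof (Hfar n z ltac:(lia) ltac:(lia) Hz) as Hf.
    pose proof (Hfar n z' ltac:(lia) ltac:(lia) Hz') as Hf'.
    rewrite Rabs_pos_eq in Hf by lra. rewrite Rabs_left in Hf' by lra.
    destruct (homeo2_iter F n HF) as [Hcn [g [_ [HgF _]]]].
    destruct (displacement_gap (Nat.iter n F) M' (- (eps * INR n)) (eps * INR n) z z')
      as [w [Hw [HFw Hdw]]]; try apply Hz; try apply Hz'; try lra.
    - exact Hcn.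
    - intros u v Huv. rewrite <- (HgF u), <- (HgF v), Huv. reflexivity.
    - apply equivariant_iter, HT.
    - pose proof (Hfar n w ltac:(lia) ltac:(lia) (conj Hw HFw)) as Hf''.
      assert (Rabs (disp (Nat.iter n F) w) < eps * INR n) by (apply Rabs_def1; lra).
      lra. }
  (* One more step keeps the displacement of [z] positive, and [z] returns to [strip M']; by
     [Hsame], a point [w] returning to [strip M] at the new time then has positive displacement
     too. *)
  assert (Hpersist : forall n k, (N <= n)%nat ->
    (exists z, returns F M n z /\ 0 < disp (Nat.iter n F) z) ->
    exists z, returns F M (k + n) z /\ 0 < disp (Nat.iter (k + n) F) z).
  { intros n k HNn Hstart. induction k as [|k IH]; [exact Hstart|].
    destruct IH as [z [Hz Hd]].
    assert (Hbk : B + 2 < eps * INR (k + n)) by (apply Hbig; lia).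
    pose proof (Hfar (k + n)%nat z ltac:(lia) ltac:(lia) (Hmono M _ z HMM' Hz)) as Hf.
    rewrite Rabs_pos_eq in Hf by lra.
    destruct (HFB (Nat.iter (k + n) F z) (proj2 Hz)) as [HsB HdB].
    apply Rabs_le_bounds in HdB.
    assert (Hz' : returns F M' (S k + n) z).
    { destruct Hz as [Hz _]. unfold returns, strip in *.
      change (Nat.iter (S k + n) F z) with (F (Nat.iter (k + n) F z)). lra. }
    assert (Hd' : 0 < disp (Nat.iter (S k + n) F) z).
    { replace (disp (Nat.iter (S k + n) F) z)
        with (disp (Nat.iter (k + n) F) z + disp F (Nat.iter (k + n) F z))
        by (unfold disp; change (Nat.iter (S k + n) F z) with (F (Nat.iter (k + n) F z)); ring).
      lra. }
    destruct (Hret (S k + n)%nat) as [w Hw]; [lia|]. exists w. split; [exact Hw|].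
    apply Hmono in Hw; [|exact HMM'].
    pose proof (Hfar (S k + n)%nat w ltac:(lia) ltac:(lia) Hw) as Hfw.
    pose proof (Hbig (S k + n)%nat ltac:(lia)).
    apply Rnot_le_lt; intros Hle.
    destruct (Req_dec (disp (Nat.iter (S k + n) F) w) 0) as [E|E].
    - rewrite E, Rabs_R0 in Hfw. lra.
    - apply (Hsame (S k + n)%nat z w); try assumption; [lia|lra]. }
  destruct (Hplus N) as [n [z [HNn [Hz Hd]]]].
  (* A negative return is taken after the positive one, and the positive sign is carried forward to
     its time [n']. *)
  destruct (Hminus n) as [n' [z' [Hnn' [Hz' Hd']]]].
  destruct (Hpersist n (n' - n)%nat HNn) as [w [Hw Hdw]].
  { exists z. split; [|exact Hd]. unfold returns, strip in *. lra. }
  replace (n' - n + n)%nat with n' in * by lia.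
  apply (Hsame n' w z'); try assumption; [lia| |].
  - apply (Hmono M); assumption.
  - apply (Hmono M0); [lra|exact Hz'].
Qed.

(** Two approximations, each within half of [Rabs r], place [rho_n] at distance less than [Rabs r]
    from [r], hence with the sign of [r]. Multiplying by [r] treats both signs at once. *)
Lemma in_rho_ann_returns (F : pt -> pt) (r : R) :
  r <> 0 -> in_rho_ann F r ->
  exists M, forall M', M <= M' -> forall m, exists n z,
    (m <= n)%nat /\ returns F M' n z /\ 0 < r * disp (Nat.iter n F) z.
Proof.
  intros Hr Hann. destruct (Hann (Rabs r / 2)) as [K [s [[_ [_ [M HM]]] [Hs Hsr]]]].
  { pose proof (Rabs_pos_lt r Hr). lra. }
  exists M. intros M' HMM' m.
  destruct (Hs m (Rabs r / 2)) as [n [z [H1 [Hm [Hz [HFz Hrho]]]]]].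
  { pose proof (Rabs_pos_lt r Hr). lra. }
  exists n, z. split; [exact Hm|]. split.
  { apply HM in Hz, HFz. unfold returns, strip. lra. }
  assert (HnR : 0 < INR n) by (apply lt_0_INR; lia).
  replace (disp (Nat.iter n F) z) with (rho_n F n z * INR n)
    by (unfold rho_n, disp, p1; field; lra).
  rewrite <- Rmult_assoc. apply Rmult_lt_0_compat; [|exact HnR].
  apply Rabs_def2 in Hsr, Hrho. revert Hsr Hrho.
  unfold Rabs; destruct (Rcase_abs r); nra.
Qed.

(** * The contradiction between lasting returns and the absence of late returns *)

Theorem mainTheorem6 (H : R -> pt -> pt) :
  lifted_isotopy H ->
  (exists r, 0 < r /\ in_rho_ann (H 1) r) ->
  (exists r, r < 0 /\ in_rho_ann (H 1) r) ->
  exists Kt : pt -> Prop, compact_annulus Kt /\ in_rho_K (H 1) Kt 0.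
Proof.
  intros HH [r [Hr Hra]] [r' [Hr' Hra']]. apply NNPP; intros Hno.
  assert (HF : homeo2 (H 1)) by (apply HH; lra).
  assert (HT : equivariant (H 1)) by (intros z; apply HH; lra).
  assert (Hrho : forall M, ~ in_rho_K (H 1) (strip M) 0).
  { intros M HM. apply Hno. exists (strip M). split; [apply compact_strip|exact HM]. }
  destruct (in_rho_ann_returns (H 1) r) as [Mp Hp]; [lra|exact Hra|].
  destruct (in_rho_ann_returns (H 1) r') as [Mm Hm]; [lra|exact Hra'|].
  set (M0 := Rmax 0 (Rmax Mp Mm)).
  assert (HM0 : 0 <= M0) by apply Rmax_l.
  assert (HMpm : Rmax Mp Mm <= M0) by apply Rmax_r.
  pose proof (Rmax_l Mp Mm). pose proof (Rmax_r Mp Mm).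
  specialize (Hp M0 ltac:(lra)). specialize (Hm M0 ltac:(lra)).
  (* Returns of both signs occur in [strip M0] at arbitrarily large times, so every larger strip is
     disjoint from one of its iterates; the image of the origin decides the direction of the
     push. *)
  assert (Hpush : forall M, M0 <= M -> exists n, (1 <= n)%nat /\
    (pushes_off 1 (Nat.iter n (H 1)) M \/ pushes_off (-1) (Nat.iter n (H 1)) M)).
  { intros M HM.
    destruct (exists_time_without_return (H 1) M0 M HF HT Hrho) as [n [Hn Hnr]].
    - intros m. destruct (Hp m) as [n [z [Hmn [Hz Hd]]]].
      exists n, z. split; [exact Hmn|]. split; [exact Hz|]. nra.
    - intros m. destruct (Hm m) as [n [z [Hmn [Hz Hd]]]].
      exists n, z. split; [exact Hmn|]. split; [exact Hz|]. nra.
    - exact HM.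
    - exists n. split; [exact Hn|].
      assert (Hbb : forall c, c = 1 \/ c = -1 -> bounded_below c (Nat.iter n (H 1))).
      { intros c Hc. clear - HH Hc. induction n as [|n IH]; [intros A; exists A; auto|].
        intros A. destruct (IH A) as [B HB].
        destruct (isotopy_bounded_below H c HH Hc B) as [B' HB'].
        exists B'. intros z Hz. apply HB', HB, Hz. }
      assert (Horig : strip M (0, 0)) by (unfold strip; simpl; rewrite Rabs_R0; lra).
      pose proof (Hnr _ Horig) as Hout.
      destruct (Rlt_dec M (1 * snd (Nat.iter n (H 1) (0, 0)))) as [Hup|Hup].
      + left. apply no_return_pushes_off; auto using homeo2_iter; lra.
      + right. apply no_return_pushes_off; auto using homeo2_iter; [lra|].
        apply Rnot_le_lt; intros Hle. apply Hout, Rabs_le. lra. }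
  assert (Hnever : exists k0, forall k z, (k0 <= k)%nat -> strip M0 z ->
    ~ strip M0 (Nat.iter k (H 1) z)).
  { destruct (Hpush M0 (Rle_refl _)) as [n1 [Hn1 [Hup|Hdown]]].
    - apply (pushed_off_never_returns 1 (H 1) M0 n1); auto using isotopy_bounded_below.
    - apply (pushed_off_never_returns (-1) (H 1) M0 n1); auto using isotopy_bounded_below.
      replace (- -1) with 1 by ring. intros M HM.
      destruct (Hpush M HM) as [n [Hn [Hu|Hd]]]; exists n; auto. }
  (* The positive rotation number supplies a return after time [k0]. *)
  destruct Hnever as [k0 Hk0]. destruct (Hp k0) as [n [z [Hkn [[Hz HFz] _]]]].
  exact (Hk0 n z Hkn Hz HFz).
Qed.
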